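(* Let $(X,\{\alpha_i\},Y,\{h_i\})$ be a root datum of finite type, let $\pi\subset X^+$ be a finite saturated set, and let $\{H_1,\dots,H_n\}$ be a $\mathbb{Z}$-basis of $Y$. Let $P_{W\pi}=\{(v^{\langle H_1,\lambda\rangle},\dots,v^{\langle H_n,\lambda\rangle})\mid\lambda\in W\pi\}\subset\mathbb{A}^n_{\mathbb{Q}(v)}$ and let $I(P_{W\pi})\subset\mathbb{Q}(v)[K_{H_1},\dots,K_{H_n}]\subset\mathbf{U}^0$ be its vanishing ideal. Then the defining ideal $\Lambda$ of the generalized $q$-Schur algebra $\mathbf{S}(\pi)=\mathbf{U}/\Lambda$ is the two-sided ideal of $\mathbf{U}$ generated by $I(P_{W\pi})$. In particular, $\Lambda$ is generated (as a two-sided ideal) by its intersection with $\mathbf{U}^0$.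
   Context: **Root datum.** A Cartan datum is a finite set $I$ with a symmetric $\mathbb{Z}$-valued bilinear form $(\ ,\ )$ on $\mathbb{Z}[I]$ such that $(i,i)\in\{2,4,6,\dots\}$ for $i\in I$ and $2(i,j)/(i,i)\in\{0,-1,-2,\dots\}$ for $i\ne j$. It is of finite type if the matrix $((i,j))_{i,j\in I}$ is positive definite. A root datum associated to it consists of finitely generated free abelian groups $X,Y$, a perfect pairing $\langle\ ,\ \rangle:Y\times X\to\mathbb{Z}$, and embeddings $I\to Y$, $i\mapsto h_i$, and $I\to X$, $i\mapsto\alpha_i$, with $\langle h_i,\alpha_j\rangle=2(i,j)/(i,i)$. The root datum is of finite type if its Cartan datum is. Put $d_i=(i,i)/2$. The Weyl group $W$ is generated by $s_i$ ($i\in I$) and acts on $X$ by $s_i(\lambda)=\lambda-\langle h_i,\lambda\rangle\alpha_i$. Write $\lambda\le\lambda'$ if $\lambda'-\lambda\in\sum_i\mathbb{N}\alpha_i$, and $X^+=\{\lambda\in X\mid\langle h_i,\lambda\rangle\in\mathbb{N}\text{ for all }i\}$. A subset $\pi\subset X^+$ is saturated if $\lambda\in\pi$, $\lambda'\in X^+$, $\lambda'\le\lambda$ imply $\lambda'\in\pi$. $W\pi\subset X$ is the union of the $W$-orbits of elements of $\pi$. **Quantized enveloping algebra.** Let $v$ be an indeterminate, $v_i=v^{d_i}$, $[n]_i=(v_i^n-v_i^{-n})/(v_i-v_i^{-1})$, $[n]_i^!=[1]_i\cdots[n]_i$. $\mathbf{U}$ is the associative unital $\mathbb{Q}(v)$-algebra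 with generators $E_i,F_i$ ($i\in I$), $K_h$ ($h\in Y$) and relations: $K_0=1$, $K_hK_{h'}=K_{h+h'}$; $K_hE_i=v^{\langle h,\alpha_i\rangle}E_iK_h$; $K_hF_i=v^{-\langle h,\alpha_i\rangle}F_iK_h$; $E_iF_j-F_jE_i=\delta_{ij}\dfrac{K_{d_ih_i}-K_{-d_ih_i}}{v_i-v_i^{-1}}$; and for $i\ne j$, $\sum_{s+s'=1-\langle h_i,\alpha_j\rangle}(-1)^{s'}E_i^{(s)}E_jE_i^{(s')}=0$ and the same with $F$ in place of $E$, where $E_i^{(s)}=E_i^s/[s]_i^!$, $F_i^{(s)}=F_i^s/[s]_i^!$. $\mathbf{U}^0$ is the subalgebra generated by all $K_h$, $h\in Y$; it is the group algebra $\mathbb{Q}(v)[Y]$. For a basis $H_1,\dots,H_n$ of $Y$ it is the Laurent polynomial ring in $K_{H_1},\dots,K_{H_n}$, and its polynomial subring $\mathbb{Q}(v)[K_{H_1},\dots,K_{H_n}]$ is regarded as the coordinate ring of $\mathbb{A}^n_{\mathbb{Q}(v)}$ with $K_{H_a}$ as the coordinate functions. **Generalized $q$-Schur algebra.** For a $\mathbf{U}$-module $V$ and $\lambda\in X$, $V_\lambda=\{m\in V\mid K_hm=v^{\langle h,\lambda\rangle}m\ \forall h\in Y\}$. $\mathcal{C}$ is the category of $\mathbf{U}$-modules $V$ with $V=\bigoplus_{\lambda\in X}V_\lambda$, and $\mathcal{C}[\pi]$ is its full subcategory of those $M$ with $M=\bigoplus_{\lambda\in W\pi}M_\lambda$.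 The defining ideal $\Lambda$ is the ideal of all elements of $\mathbf{U}$ annihilating every object of $\mathcal{C}[\pi]$, and $\mathbf{S}(\pi)=\mathbf{U}/\Lambda$. *)

(* Defs.v *)
From HB Require Import structures.
From mathcomp Require Import all_boot all_order all_algebra.
From mathcomp Require Import generic_quotient ring_quotient finmap boolp Rstruct.
From mathcomp Require Import mpoly monalg.

Set Implicit Arguments.
Unset Strict Implicit.
Unset Printing Implicit Defensive.

Import Order.TTheory GRing.Theory Num.Theory.
Local Open Scope ring_scope.

Inductive ideal_gen (A : pzRingType) (S : A -> Prop) : A -> Prop :=
| ideal_gen_mem x : S x -> ideal_gen S x
| ideal_gen0 : ideal_gen S 0
| ideal_genD x y : ideal_gen S x -> ideal_gen S y -> ideal_gen S (x + y)
| ideal_genMl a x : ideal_gen S x -> ideal_gen S (a * x)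
| ideal_genMr a x : ideal_gen S x -> ideal_gen S (x * a).

Section AlgQuotient.
Variables (K : nzRingType) (A : algType K) (S : A -> Prop).

Definition ideal_pred : {pred A} := fun x => `[< ideal_gen S x >].

Lemma ideal_predP x : reflect (ideal_gen S x) (x \in ideal_pred).
Proof. exact: asboolP. Qed.

Lemma ideal_pred_zmod_closed : zmod_closed ideal_pred.
Proof.
split; first by apply/ideal_predP/ideal_gen0.
move=> x y /ideal_predP Sx /ideal_predP Sy; apply/ideal_predP.
by apply: ideal_genD => //; rewrite -mulN1r; apply: ideal_genMl.
Qed.
HB.instance Definition _ :=
  GRing.isZmodClosed.Build A ideal_pred ideal_pred_zmod_closed.

Hypothesis S1 : ~ ideal_gen S 1.

(* [S1] appears in the type because [nzRingType] requires [1 != 0]. *)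
Definition alg_quot of ~ ideal_gen S 1 : Type := Quotient.quot ideal_pred.

Local Notation Q := (alg_quot S1).

HB.instance Definition _ := GRing.Zmodule.on Q.

(* Sealed, like the operations below, so that conversion does not unfold it. *)
Fact alg_quot_key : unit. Proof. by []. Qed.
Definition alg_pi : A -> Q :=
  locked_with alg_quot_key (fun x => \pi_(Quotient.quot ideal_pred)%qT x).

Lemma alg_piE x : alg_pi x = \pi_(Quotient.quot ideal_pred)%qT x.
Proof. by rewrite /alg_pi unlock. Qed.

Lemma alg_piP x y : alg_pi x = alg_pi y <-> ideal_gen S (x - y).
Proof.
rewrite !alg_piE; split=> [/eqP|Sxy]; first by rewrite -Quotient.idealrBE => /ideal_predP.
by apply/eqP; rewrite -Quotient.idealrBE; apply/ideal_predP.
Qed.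

Lemma alg_pi_surj (q : Q) : {x | q = alg_pi x}.
Proof. by exists (repr q); rewrite alg_piE reprK. Qed.

Lemma alg_pi_zmod : zmod_morphism alg_pi.
Proof. by move=> x y; rewrite !alg_piE raddfB. Qed.
HB.instance Definition _ := GRing.isZmodMorphism.Build A Q alg_pi alg_pi_zmod.

Definition alg_quot_one : Q := alg_pi 1.
Definition alg_quot_mul : Q -> Q -> Q :=
  locked_with alg_quot_key (fun p q => alg_pi (repr p * repr q)).
Definition alg_quot_scale : K -> Q -> Q :=
  locked_with alg_quot_key (fun k q => alg_pi (k *: repr q)).

Lemma alg_repr x : ideal_gen S (repr (alg_pi x) - x).
Proof. by apply/alg_piP; rewrite [LHS]alg_piE reprK. Qed.

Lemma alg_pi_mul x y : alg_quot_mul (alg_pi x) (alg_pi y) = alg_pi (x * y).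
Proof.
rewrite /alg_quot_mul unlock; apply/alg_piP; set x' := repr _; set y' := repr _.
rewrite (_ : _ - _ = x' * (y' - y) + (x' - x) * y); last first.
  by rewrite mulrBr mulrBl addrA subrK.
by apply: ideal_genD; [apply: ideal_genMl|apply: ideal_genMr]; apply: alg_repr.
Qed.

Lemma alg_pi_scale k x : alg_quot_scale k (alg_pi x) = alg_pi (k *: x).
Proof.
by rewrite /alg_quot_scale unlock; apply/alg_piP; rewrite -scalerBr -mulr_algl; apply/ideal_genMl/alg_repr.
Qed.

Fact alg_quot_mulA : associative alg_quot_mul.
Proof.
move=> p q r; have [[[x ->] [y ->]] [z ->]] :=
  (alg_pi_surj p, alg_pi_surj q, alg_pi_surj r).
by rewrite !alg_pi_mul mulrA.
Qed.
Fact alg_quot_mul1 : left_id alg_quot_one alg_quot_mul.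
Proof. by move=> p; have [x ->] := alg_pi_surj p; rewrite alg_pi_mul mul1r. Qed.
Fact alg_quot_mulr1 : right_id alg_quot_one alg_quot_mul.
Proof. by move=> p; have [x ->] := alg_pi_surj p; rewrite alg_pi_mul mulr1. Qed.
Fact alg_quot_mulDl : left_distributive alg_quot_mul +%R.
Proof.
move=> p q r; have [[[x ->] [y ->]] [z ->]] :=
  (alg_pi_surj p, alg_pi_surj q, alg_pi_surj r).
by rewrite -raddfD !alg_pi_mul mulrDl raddfD.
Qed.
Fact alg_quot_mulDr : right_distributive alg_quot_mul +%R.
Proof.
move=> p q r; have [[[x ->] [y ->]] [z ->]] :=
  (alg_pi_surj p, alg_pi_surj q, alg_pi_surj r).
by rewrite -raddfD !alg_pi_mul mulrDr raddfD.
Qed.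
Fact alg_quot_neq0 : alg_quot_one != 0.
Proof.
by apply/eqP; rewrite -(raddf0 alg_pi) => /alg_piP; rewrite subr0; apply: S1.
Qed.
HB.instance Definition _ := GRing.Zmodule_isNzRing.Build Q alg_quot_mulA
  alg_quot_mul1 alg_quot_mulr1 alg_quot_mulDl alg_quot_mulDr alg_quot_neq0.

Fact alg_quot_scaleA a b p :
  alg_quot_scale a (alg_quot_scale b p) = alg_quot_scale (a * b) p.
Proof.
by have [x ->] := alg_pi_surj p; rewrite !alg_pi_scale scalerA.
Qed.
Fact alg_quot_scale1 : left_id 1 alg_quot_scale.
Proof.
by move=> p; have [x ->] := alg_pi_surj p; rewrite alg_pi_scale scale1r.
Qed.
Fact alg_quot_scaleDr : right_distributive alg_quot_scale +%R.
Proof.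
move=> a p q; have [[x ->] [y ->]] := (alg_pi_surj p, alg_pi_surj q).
by rewrite -raddfD !alg_pi_scale scalerDr raddfD.
Qed.
Fact alg_quot_scaleDl p : {morph alg_quot_scale^~ p : a b / a + b}.
Proof.
move=> a b /=; have [x ->] := alg_pi_surj p.
by rewrite !alg_pi_scale scalerDl raddfD.
Qed.
HB.instance Definition _ := GRing.Zmodule_isLmodule.Build K Q
  alg_quot_scaleA alg_quot_scale1 alg_quot_scaleDr alg_quot_scaleDl.

Fact alg_quot_scaleAl (a : K) (p q : Q) : a *: (p * q) = (a *: p) * q.
Proof.
have [[x ->] [y ->]] := (alg_pi_surj p, alg_pi_surj q).
change (alg_quot_scale a (alg_quot_mul (alg_pi x) (alg_pi y)) =
  alg_quot_mul (alg_quot_scale a (alg_pi x)) (alg_pi y)).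
by rewrite !(alg_pi_mul, alg_pi_scale) scalerAl.
Qed.
HB.instance Definition _ := GRing.Lmodule_isLalgebra.Build K Q alg_quot_scaleAl.

Fact alg_quot_scaleAr (a : K) (p q : Q) : a *: (p * q) = p * (a *: q).
Proof.
have [[x ->] [y ->]] := (alg_pi_surj p, alg_pi_surj q).
change (alg_quot_scale a (alg_quot_mul (alg_pi x) (alg_pi y)) =
  alg_quot_mul (alg_pi x) (alg_quot_scale a (alg_pi y))).
by rewrite !(alg_pi_mul, alg_pi_scale) scalerAr.
Qed.
HB.instance Definition _ := GRing.Lalgebra_isAlgebra.Build K Q alg_quot_scaleAr.

Fact alg_pi_monoid : monoid_morphism alg_pi.
Proof. by split=> // x y; rewrite -alg_pi_mul. Qed.
HB.instance Definition _ := GRing.isMonoidMorphism.Build A Q alg_pi alg_pi_monoid.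

Fact alg_pi_scalable : scalable alg_pi.
Proof. by move=> k x; rewrite -alg_pi_scale. Qed.
HB.instance Definition _ := GRing.isScalable.Build K A Q *:%R alg_pi alg_pi_scalable.

End AlgQuotient.

Fact malg_scaleAr (K : comNzRingType) (M : monomType) (k : K)
    (x y : {malg K[M]}) : k *: (x * y) = x * (k *: y).
Proof.
apply/malgP => w; rewrite mcoeffZ mcoeffMl.
rewrite (@mcoeffMlw _ _ (monalg.msupp x) (monalg.msupp y) x (k *: y)) //;
  last exact: monalg.msuppZ_le.
rewrite mulr_sumr; apply: eq_bigr => w1 _.
rewrite mulr_sumr; apply: eq_bigr => w2 _.
by rewrite mcoeffZ mulrnAr mulrCA.
Qed.

(* The operations are those of the monoid algebra of the free monoid on G,
   sealed so that conversion does not unfold them. *)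
Definition free_alg (K : comNzRingType) (G : choiceType) : Type :=
  {malg K[fmonom G]}.

Section FreeAlg.
Variables (K : comNzRingType) (G : choiceType).

Local Notation M := {malg K[fmonom G]}.
Local Notation F := (free_alg K G).

HB.instance Definition _ := Choice.on F.

Fact free_alg_key : unit. Proof. by []. Qed.
Local Notation sealed := (locked_with free_alg_key).
Definition free_alg0 : F := sealed (0 : M).
Definition free_alg1 : F := sealed (1 : M).
Definition free_alg_opp : F -> F := sealed (fun x : M => - x).
Definition free_alg_add : F -> F -> F := sealed (fun x y : M => x + y).
Definition free_alg_mul : F -> F -> F := sealed (fun x y : M => x * y).
Definition free_alg_scale : K -> F -> F := sealed (fun k (x : M) => k *: x).

Lemma free_alg0E : free_alg0 = 0 :> M.
Proof. by rewrite /free_alg0 unlock. Qed.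
Lemma free_alg1E : free_alg1 = 1 :> M.
Proof. by rewrite /free_alg1 unlock. Qed.
Lemma free_alg_oppE (x : M) : free_alg_opp x = - x.
Proof. by rewrite /free_alg_opp unlock. Qed.
Lemma free_alg_addE (x y : M) : free_alg_add x y = x + y.
Proof. by rewrite /free_alg_add unlock. Qed.
Lemma free_alg_mulE (x y : M) : free_alg_mul x y = x * y.
Proof. by rewrite /free_alg_mul unlock. Qed.
Lemma free_alg_scaleE k (x : M) : free_alg_scale k x = k *: x.
Proof. by rewrite /free_alg_scale unlock. Qed.
Local Definition free_algE := (free_alg0E, free_alg1E, free_alg_oppE,
  free_alg_addE, free_alg_mulE, free_alg_scaleE).

Fact free_alg_addA : associative free_alg_add.
Proof. by move=> x y z; rewrite !free_algE addrA. Qed.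
Fact free_alg_addC : commutative free_alg_add.
Proof. by move=> x y; rewrite !free_algE addrC. Qed.
Fact free_alg_add0 : left_id free_alg0 free_alg_add.
Proof. by move=> x; rewrite !free_algE add0r. Qed.
Fact free_alg_addN : left_inverse free_alg0 free_alg_opp free_alg_add.
Proof. by move=> x; rewrite !free_algE addNr. Qed.
HB.instance Definition _ := GRing.isZmodule.Build F
  free_alg_addA free_alg_addC free_alg_add0 free_alg_addN.

Fact free_alg_mulA : associative free_alg_mul.
Proof. by move=> x y z; rewrite !free_algE mulrA. Qed.
Fact free_alg_mul1 : left_id free_alg1 free_alg_mul.
Proof. by move=> x; rewrite !free_algE mul1r. Qed.
Fact free_alg_mulr1 : right_id free_alg1 free_alg_mul.
Proof. by move=> x; rewrite !free_algE mulr1. Qed.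
Fact free_alg_mulDl : left_distributive free_alg_mul free_alg_add.
Proof. by move=> x y z; rewrite !free_algE mulrDl. Qed.
Fact free_alg_mulDr : right_distributive free_alg_mul free_alg_add.
Proof. by move=> x y z; rewrite !free_algE mulrDr. Qed.
Fact free_alg_neq0 : free_alg1 != 0.
Proof. by rewrite -[0]/free_alg0 !free_algE oner_neq0. Qed.
HB.instance Definition _ := GRing.Zmodule_isNzRing.Build F free_alg_mulA
  free_alg_mul1 free_alg_mulr1 free_alg_mulDl free_alg_mulDr free_alg_neq0.

Fact free_alg_scaleA a b x :
  free_alg_scale a (free_alg_scale b x) = free_alg_scale (a * b) x.
Proof. by rewrite !free_algE scalerA. Qed.
Fact free_alg_scale1 : left_id 1 free_alg_scale.
Proof. by move=> x; rewrite !free_algE scale1r. Qed.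
Fact free_alg_scaleDr : right_distributive free_alg_scale free_alg_add.
Proof. by move=> a x y; rewrite !free_algE scalerDr. Qed.
Fact free_alg_scaleDl x : {morph free_alg_scale^~ x : a b / a + b >-> free_alg_add a b}.
Proof. by move=> a b /=; rewrite !free_algE scalerDl. Qed.
HB.instance Definition _ := GRing.Zmodule_isLmodule.Build K F
  free_alg_scaleA free_alg_scale1 free_alg_scaleDr free_alg_scaleDl.

Fact free_alg_scaleAl (k : K) (x y : F) :
  free_alg_scale k (free_alg_mul x y) = free_alg_mul (free_alg_scale k x) y.
Proof. by rewrite !free_algE scalerAl. Qed.
HB.instance Definition _ := GRing.Lmodule_isLalgebra.Build K F free_alg_scaleAl.

Fact free_alg_scaleAr (k : K) (x y : F) :
  free_alg_scale k (free_alg_mul x y) = free_alg_mul x (free_alg_scale k y).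
Proof. by rewrite !free_algE malg_scaleAr. Qed.
HB.instance Definition _ := GRing.Lalgebra_isAlgebra.Build K F free_alg_scaleAr.

Definition free_gen : G -> F :=
  sealed (fun g => mkmalgU (fmu g) 1 : M).

Section Eval.
Variables (A : algType K) (e : G -> A).

Definition free_eval_word (w : monalg.fmonom G) : A :=
  \prod_(g <- monalg.fmonom_val w) e g.

Fact free_eval_word_mmorphism : monalg.mmorphism free_eval_word.
Proof.
split=> [x y|]; rewrite /free_eval_word.
  by rewrite monalg.fmM big_cat.
by rewrite monalg.fm1 big_nil.
Qed.
HB.instance Definition _ := monalg.isMultiplicative.Build
  (monalg.fmonom G) A free_eval_word free_eval_word_mmorphism.

Definition free_eval : free_alg K G -> A := monalg.mmap (in_alg A) free_eval_word.

Fact free_eval_zmod : zmod_morphism free_eval.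
Proof.
move=> x y; rewrite [x - y]free_alg_addE [- y]free_alg_oppE.
exact: (raddfB (monalg.mmap (in_alg A) free_eval_word : {additive M -> A})).
Qed.
HB.instance Definition _ := GRing.isZmodMorphism.Build F A free_eval free_eval_zmod.

Fact free_eval_monoid : monoid_morphism free_eval.
Proof.
split; first by rewrite [1]free_alg1E; apply: monalg.mmap1.
move=> x y; rewrite [x * y]free_alg_mulE.
apply: (monalg.commr_mmap_is_multiplicative _).1 => g m m' /=.
by rewrite /GRing.comm mulr_algl mulr_algr.
Qed.
HB.instance Definition _ := GRing.isMonoidMorphism.Build F A free_eval free_eval_monoid.

Fact free_eval_scalable : scalable free_eval.
Proof.
by move=> k x; rewrite [k *: x]free_alg_scaleE /free_eval monalg.mmapZ mulr_algl.
Qed.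
HB.instance Definition _ :=
  GRing.isScalable.Build K F A *:%R free_eval free_eval_scalable.

Lemma free_eval_gen g : free_eval (free_gen g) = e g.
Proof.
rewrite /free_eval /free_gen unlock monalg.mmapU /= scale1r mul1r.
by rewrite /free_eval_word monalg.fmuE big_seq1.
Qed.

End Eval.
End FreeAlg.
Arguments free_gen {K G} g.

(* The form on Z[I] is given by its Gram matrix [cd_form]. *)
Record cartan_datum := CartanDatum {
  cd_index :> finType;
  cd_form : cd_index -> cd_index -> int;
  cd_sym : forall i j, cd_form i j = cd_form j i;
  cd_diag : forall i, exists m : nat, cd_form i i = 2 * m.+1%:Z;
  cd_offdiag : forall i j, i != j ->
    exists m : nat, 2 * cd_form i j = - m%:Z * cd_form i i }.

Definition finite_type (C : cartan_datum) : Prop :=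
  forall x : C -> Rdefinitions.R, (exists i, x i != 0) ->
    0 < \sum_i \sum_j x i * x j * (cd_form i j)%:~R.

Definition Zbasis (M : zmodType) (n : nat) (b : 'I_n -> M) : Prop :=
  forall y : M, exists! c : {ffun 'I_n -> int}, y = \sum_a b a *~ c a.

Record root_datum (C : cartan_datum) := RootDatum {
  rd_X : zmodType;
  rd_Y : zmodType;
  rd_X_free : exists n (b : 'I_n -> rd_X), Zbasis b;
  rd_Y_free : exists n (b : 'I_n -> rd_Y), Zbasis b;
  rd_pair : rd_Y -> rd_X -> int;
  rd_pairDl : forall y y' x, rd_pair (y + y') x = rd_pair y x + rd_pair y' x;
  rd_pairDr : forall y x x', rd_pair y (x + x') = rd_pair y x + rd_pair y x';
  rd_perfectl : forall f : {additive rd_X -> int},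
    exists! y, forall x, f x = rd_pair y x;
  rd_perfectr : forall f : {additive rd_Y -> int},
    exists! x, forall y, f y = rd_pair y x;
  rd_coroot : C -> rd_Y;
  rd_root : C -> rd_X;
  rd_coroot_inj : injective rd_coroot;
  rd_root_inj : injective rd_root;
  rd_cartan : forall i j,
    rd_pair (rd_coroot i) (rd_root j) * cd_form i i = 2 * cd_form i j }.

Definition Qv : fieldType := {fraction {poly rat}}.
Definition qv : Qv := tofrac 'X.

Section RootDatum.
Variables (C : cartan_datum) (D : root_datum C).
Local Notation X := (rd_X D).
Local Notation Y := (rd_Y D).
Local Notation "<< h , x >>" := (rd_pair h x).
Local Notation "'h_ i" := (rd_coroot D i) (at level 8, i at level 2).
Local Notation "'a_ i" := (rd_root D i) (at level 8, i at level 2).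

Definition reflection (i : C) (x : X) : X := x - 'a_i *~ << 'h_i, x >>.

(* The reflections are involutions, so the group they generate is the monoid
   they generate. *)
Inductive weyl : (X -> X) -> Prop :=
| weyl_id : weyl id
| weyl_refl i w : weyl w -> weyl (reflection i \o w).

Definition weight_le (x x' : X) : Prop :=
  exists c : C -> nat, x' - x = \sum_i 'a_i *+ c i.

Definition dominant (x : X) : Prop := forall i, 0 <= << 'h_i, x >>.

Definition saturated (pi : {fset X}) : Prop :=
  (forall x, x \in pi -> dominant x) /\
  (forall x x', x \in pi -> dominant x' -> weight_le x' x -> x' \in pi).

Definition weyl_orbits (pi : {fset X}) (x : X) : Prop :=
  exists w y, [/\ weyl w, y \in pi & x = w y].

(* [K] and [v] stand for Q(v) and its indeterminate, i.e. [Qv] and [qv]. *)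
Variables (K : fieldType) (v : K).

Definition cd_d (i : C) : int := (cd_form i i %/ 2)%Z.
Definition v_ (i : C) : K := v ^ cd_d i.
Definition qint (i : C) (n : nat) : K :=
  (v_ i ^+ n - v_ i ^- n) / (v_ i - (v_ i)^-1).
Definition qfact (i : C) (n : nat) : K := \prod_(1 <= k < n.+1) qint i k.

Definition Ugen : choiceType := (C + C + Y)%type.

Local Notation FU := (free_alg K Ugen).

Definition preE (i : C) : FU := free_gen (inl (inl i) : Ugen).
Definition preF (i : C) : FU := free_gen (inl (inr i) : Ugen).
Definition preK (h : Y) : FU := free_gen (inr h : Ugen).

Definition divided_power (i : C) (x : FU) (s : nat) : FU :=
  (qfact i s)^-1 *: x ^+ s.

Definition serre (x : C -> FU) (i j : C) : FU :=
  let N := `|(1 - << 'h_i, 'a_j >>)%R|%N in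
  \sum_(s < N.+1) (-1) ^+ (N - s) *:
    (divided_power i (x i) s * x j * divided_power i (x i) (N - s)).

Inductive Urel : FU -> Prop :=
| Urel_K0 : Urel (preK 0 - 1)
| Urel_KD h h' : Urel (preK h * preK h' - preK (h + h'))
| Urel_KE h i : Urel (preK h * preE i - v ^ << h, 'a_i >> *: (preE i * preK h))
| Urel_KF h i :
    Urel (preK h * preF i - v ^ (- << h, 'a_i >>) *: (preF i * preK h))
| Urel_EF i j : Urel (preE i * preF j - preF j * preE i
    - (if i == j then (v_ i - (v_ i)^-1)^-1 *:
         (preK ('h_i *~ cd_d i) - preK ('h_i *~ (- cd_d i))) else 0))
| Urel_serreE i j : i != j -> Urel (serre preE i j)
| Urel_serreF i j : i != j -> Urel (serre preF i j).

Definition counit_gen (g : Ugen) : K^o := if g is inr _ then 1 else 0.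

Lemma Urel_nontrivial : ~ ideal_gen Urel 1.
Proof.
have [eps epsP] : exists eps : {lrmorphism FU -> K^o},
    forall g, eps (free_gen g) = counit_gen g.
  by exists (free_eval (counit_gen : Ugen -> K^o)); apply: free_eval_gen.
have epsE i : eps (preE i) = 0 by rewrite epsP.
have epsF i : eps (preF i) = 0 by rewrite epsP.
have epsK h : eps (preK h) = 1 by rewrite epsP.
have eps_serre x i j : eps (x j) = 0 -> eps (serre x i j) = 0.
  move=> xj0; rewrite raddf_sum big1 //= => s _.
  by rewrite linearZ /= !rmorphM /= xj0 mulr0 mul0r scaler0.
have eps_rel x : Urel x -> eps x = 0.
  case=> [|h h'|h i|h i|i j|i j _|i j _].
  - by rewrite rmorphB rmorph1 /= epsK subrr.
  - by rewrite rmorphB rmorphM /= !epsK mulr1 subrr.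
  - by rewrite rmorphB /= linearZ /= !rmorphM /= epsE mul0r mulr0 scaler0 subrr.
  - by rewrite rmorphB /= linearZ /= !rmorphM /= epsF mul0r mulr0 scaler0 subrr.
  - rewrite !rmorphB !rmorphM /= epsE epsF mul0r subrr sub0r.
    case: eqP => _; last by rewrite rmorph0 oppr0.
    by rewrite linearZ rmorphB /= !epsK subrr scaler0 oppr0.
  - exact: eps_serre.
  - exact: eps_serre.
have eps_ideal x : ideal_gen Urel x -> eps x = 0.
  elim=> [y /eps_rel //||y z _ y0 _ z0|a y _ y0|a y _ y0].
  - by rewrite rmorph0.
  - by rewrite rmorphD /= y0 z0 addr0.
  - by rewrite rmorphM /= y0 mulr0.
  - by rewrite rmorphM /= y0 mul0r.
by move=> /eps_ideal /eqP; rewrite rmorph1 oner_eq0.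
Qed.

Definition U : algType K := alg_quot Urel_nontrivial.

Definition UE (i : C) : U := alg_pi Urel_nontrivial (preE i).
Definition UF (i : C) : U := alg_pi Urel_nontrivial (preF i).
Definition UK (h : Y) : U := alg_pi Urel_nontrivial (preK h).

Inductive U0 : U -> Prop :=
| U0_K h : U0 (UK h)
| U0_1 : U0 1
| U0_D x y : U0 x -> U0 y -> U0 (x + y)
| U0_M x y : U0 x -> U0 y -> U0 (x * y)
| U0_Z (k : K) x : U0 x -> U0 (k *: x).

Definition weight_space (V : lmodType U) (x : X) (m : V) : Prop :=
  forall h : Y, UK h *: m = (v ^ << h, x >>)%:A *: m.

Definition weight_direct_sum (P : X -> Prop) (V : lmodType U) : Prop :=
  (forall m : V, exists (s : {fset X}) (f : X -> V),
     (forall x, x \in s -> P x /\ weight_space x (f x)) /\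
     m = \sum_(x <- s) f x) /\
  (forall (s : {fset X}) (f : X -> V),
     (forall x, x \in s -> P x /\ weight_space x (f x)) ->
     \sum_(x <- s) f x = 0 -> forall x, x \in s -> f x = 0).

Definition in_C (V : lmodType U) : Prop := weight_direct_sum (fun=> True) V.

Definition in_Cpi (pi : {fset X}) (V : lmodType U) : Prop :=
  in_C V /\ weight_direct_sum (weyl_orbits pi) V.

Definition defining_ideal (pi : {fset X}) (u : U) : Prop :=
  forall V : lmodType U, in_Cpi pi V -> forall m : V, u *: m = 0.

Definition vanishing_ideal (n : nat) (P : ('I_n -> K) -> Prop)
    (p : mpoly.mpoly n K) : Prop :=
  forall z, P z -> p.@[z] = 0.

Definition weight_points (pi : {fset X}) (n : nat) (H : 'I_n -> Y)
    (z : 'I_n -> K) : Prop :=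
  exists2 x, weyl_orbits pi x & forall a, z a = v ^ << H a, x >>.

(* The map Q(v)[X_1, ..., X_n] -> U sending X_a to K_{H_a}; it is the inclusion
   of Q(v)[K_{H_1}, ..., K_{H_n}] when H is a Z-basis of Y. *)
Definition mpoly_to_U (n : nat) (H : 'I_n -> Y) (p : mpoly.mpoly n K) : U :=
  mpoly.mmap (in_alg U) (fun a => UK (H a)) p.

Definition vanishing_ideal_U (pi : {fset X}) (n : nat) (H : 'I_n -> Y)
    (u : U) : Prop :=
  exists2 p, vanishing_ideal (weight_points pi H) p & u = mpoly_to_U H p.

End RootDatum.

(* Main.v *)
From HB Require Import structures.
Require Import Defs.
From mathcomp Require Import all_boot all_order all_algebra.
From mathcomp Require Import finmap boolp Rstruct ring lra zify.
From mathcomp Require Import mpoly.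

Set Implicit Arguments.
Unset Strict Implicit.
Unset Printing Implicit Defensive.

(** Write W.pi for the set of weights in question, J for the two-sided ideal
    generated by the polynomials in the K_{H_a} that vanish on the points
    attached to W.pi, and Lambda for the defining ideal.

    J lies in Lambda because a polynomial p in the K_{H_a} acts on a weight
    space of weight x as the scalar p(v^<H_1,x>, ..., v^<H_n,x>)
    ([mmap_eigenvector]), and an object of C[pi] is spanned by its weight
    spaces for weights in W.pi.

    For the converse it is enough that U/J, as a left U-module, is an object of
    C[pi] ([quot_in_Cpi]): then an element u of Lambda kills the class of 1,
    that is, u lies in J.  When W.pi is finite, Lagrange interpolation gives
    polynomials p_x, for x in W.pi, with value 1 at the point of x and 0 at the
    other points ([lagrange_mpoly]).  Their images e_x in U satisfy modulo J the
    relations sum_x e_x = 1 and K_{H_a} e_x = v^<H_a,x> e_x, since the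
    corresponding polynomials vanish on all the points.  Hence U/J is the sum of
    the subspaces e_x U/J, and e_x U/J consists of vectors of weight x.  Distinct
    weights give distinct points because H is a basis of Y, the pairing is
    perfect and v is not a root of unity; so the sum is direct.

    The finiteness of W.pi is where finite type enters ([weyl_orbit_finite]).
    An element of the orbit of x has the form x - sum_i c_i alpha_i, and
    invariance of the form forces (c,c) = 2 (c,x), where (alpha_i,x) means
    (i,i)<h_i,x>/2.  Positive definiteness leaves finitely many integral c on
    this quadric.

    Finally J is generated by elements of U^0 that lie in Lambda, so Lambda = J
    is generated by its intersection with U^0. *)

Import Order.TTheory GRing.Theory Num.Theory.
Local Open Scope ring_scope.

(** * Finiteness of Weyl orbits *)

(** If w represents the linear form l, that is l(x) = (x,w), then
    (x - w, x - w) >= 0 reads 2 l(x) <= (x,x) + (w,w).  Such a w exists because a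
    positive definite Gram matrix is invertible. *)
Lemma form_dominates_linear (C : cartan_datum) (l : C -> Rdefinitions.R) :
  finite_type C ->
  exists b : Rdefinitions.R, forall x : C -> Rdefinitions.R,
    2 * (\sum_i x i * l i) <=
      (\sum_i \sum_j x i * x j * (cd_form i j)%:~R) + b.
Proof.
move=> Cfin.
pose row (x : C -> Rdefinitions.R) : 'rV_#|C| := \row_a x (enum_val a).
pose G : 'M[Rdefinitions.R]_#|C| :=
  \matrix_(a, b) (cd_form (enum_val a) (enum_val b))%:~R.
have row_coords (u : 'rV_#|C|) : u = row (fun i => u 0 (enum_rank i)).
  by apply/rowP => a; rewrite mxE enum_valK.
have dotE x y : (row x *m (row y)^T) 0 0 = \sum_i x i * y i.
  rewrite mxE [RHS](reindex (enum_val : 'I_#|C| -> C)) /=; last first.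
    exact/onW_bij/enum_val_bij.
  by apply: eq_bigr => a _; rewrite !mxE.
have GE x : (row x *m G *m (row x)^T) 0 0
    = \sum_i \sum_j x i * x j * (cd_form i j)%:~R.
  have -> : row x *m G = row (fun j => \sum_i x i * (cd_form i j)%:~R).
    apply/matrixP => a b; rewrite !mxE.
    rewrite [RHS](reindex (enum_val : 'I_#|C| -> C)) /=; last first.
      exact/onW_bij/enum_val_bij.
    by apply: eq_bigr => c _; rewrite !mxE.
  rewrite dotE exchange_big; apply: eq_bigr => j _ /=.
  by rewrite mulr_suml; apply: eq_bigr => i _; rewrite mulrAC.
have G_sym : G^T = G by apply/matrixP => a b; rewrite !mxE cd_sym.
have G_ge0 (u : 'rV_#|C|) : 0 <= (u *m G *m u^T) 0 0.
  pose x i := u 0 (enum_rank i); rewrite (row_coords u) -/x GE.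
  have [[i xi]|x0] := pselect (exists i, x i != 0).
    by apply/ltW/Cfin; exists i.
  rewrite big1 // => i _; rewrite big1 // => j _.
  have [->|xi] := eqVneq (x i) 0; first by rewrite !mul0r.
  by case: x0; exists i.
have G_unit : G \in unitmx.
  rewrite -row_free_unit; apply/inj_row_free => u uG0.
  apply/rowP => a; rewrite [RHS]mxE; apply/eqP/negPn/negP => ua0.
  have := Cfin (fun i => u 0 (enum_rank i)).
  rewrite -GE -row_coords uG0 mul0mx mxE ltxx => F; suff: false by [].
  by apply: F; exists (enum_val a); rewrite enum_valK.
have [w wG] : exists w, w *m G = row l.
  by exists (row l *m invmx G); rewrite mulmxKV.
have Gw : G *m w^T = (row l)^T by rewrite -wG trmx_mul G_sym.
exists ((w *m G *m w^T) 0 0) => x; rewrite -GE -dotE.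
have := G_ge0 (row x - w).
have lx : row l *m (row x)^T = (row x *m (row l)^T)^T.
  by rewrite trmx_mul trmxK.
rewrite mulmxBl wG [(_ - _)^T]raddfB /= mulmxBl !mulmxBr -[_ *m G *m w^T]mulmxA.
rewrite Gw lx; move: (row x *m G *m _) (row x *m _) (row l *m _) => p q r.
by rewrite !mxE; lra.
Qed.

Section WeylOrbits.
Variables (C : cartan_datum) (D : root_datum C).
Local Notation "<< h , x >>" := (rd_pair h x).
Local Notation "'h_ i" := (rd_coroot D i) (at level 8, i at level 2).
Local Notation "'a_ i" := (rd_root D i) (at level 8, i at level 2).

Lemma rd_pair_zmod_morphism (h : rd_Y D) : zmod_morphism (@rd_pair _ D h).
Proof.
move=> x y; apply/eqP; rewrite eq_sym subr_eq; apply/eqP.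
by rewrite -rd_pairDr subrK.
Qed.
HB.instance Definition _ (h : rd_Y D) := GRing.isZmodMorphism.Build
  (rd_X D) int (@rd_pair _ D h) (rd_pair_zmod_morphism h).

(** The equation on c is (x - c, x - c) = (x, x) with (x, x) cancelled, which
    makes sense although the form is not defined on X: only the numbers
    2 (alpha_i, x) = (i,i)<h_i,x> occur in it.  A reflection s_i adds
    k = <h_i, w x> to c_i, and this preserves the equation. *)
Lemma weyl_orbit_quadric (x : rd_X D) w : weyl w ->
  exists c : C -> int, w x = x - \sum_i 'a_i *~ c i /\
    \sum_i \sum_j c i * c j * cd_form i j
      = \sum_i c i * (cd_form i i * <<'h_i, x>>).
Proof.
elim=> [|i {}w _ [c [wx qc]]].
  exists (fun=> 0); split; first by rewrite big1 ?subr0.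
  by rewrite !big1 // => i _; rewrite ?big1 ?mul0r // => j _; rewrite !mul0r.
set k := << 'h_i, w x >>.
exists (fun j => c j + (if j == i then k else 0)); split.
  rewrite /= /reflection -/k wx -addrA -opprD; congr (_ - _).
  under [RHS]eq_bigr do rewrite mulrzDr.
  rewrite big_split /=; congr (_ + _).
  by rewrite (bigD1 i) //= eqxx big1 ?addr0 // => j /negPf->.
have kE : cd_form i i * k = cd_form i i * <<'h_i, x>>
    - 2 * \sum_j c j * cd_form i j.
  rewrite /k wx raddfB mulrBr raddf_sum /= mulr_sumr mulr_sumr.
  congr (_ - _); apply: eq_bigr => j _.
  rewrite raddfMz /= -mulrzr intz [LHS]mulrCA mulrA rd_cartan.
  by rewrite mulrAC -mulrA.
have dE (f : C -> int) : \sum_j (if j == i then k else 0) * f j = k * f i.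
  by rewrite (bigD1 i) //= eqxx big1 ?addr0 // => j /negPf->; rewrite mul0r.
have -> : \sum_a \sum_b (c a + (if a == i then k else 0)) *
      (c b + (if b == i then k else 0)) * cd_form a b
    = \sum_a \sum_b c a * c b * cd_form a b
      + 2 * k * (\sum_j c j * cd_form i j) + k * (k * cd_form i i).
  transitivity (\sum_a (c a * (\sum_b c b * cd_form a b + k * cd_form a i)
     + (if a == i then k else 0) *
         (\sum_b c b * cd_form a b + k * cd_form a i))).
    apply: eq_bigr => a _; rewrite -mulrDl -dE -big_split /= mulr_sumr.
    by apply: eq_bigr => b _; rewrite -mulrDl mulrA.
  rewrite big_split /= dE mulrDr.
  under eq_bigr do rewrite mulrDr mulr_sumr.
  rewrite big_split /=.
  have -> : \sum_a c a * (k * cd_form a i) = k * \sum_j c j * cd_form i j.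
    by rewrite mulr_sumr; apply: eq_bigr => a _; rewrite cd_sym mulrCA.
  under eq_bigr do under eq_bigr do rewrite mulrA.
  ring.
under [RHS]eq_bigr do rewrite mulrDl.
rewrite big_split /= dE -qc -addrA; congr (_ + _).
by rewrite [k * cd_form i i]mulrC kE; ring.
Qed.

Hypothesis Cfin : finite_type C.

(** Applying [form_dominates_linear] to m/2 + c_i and to m/2 - c_i bounds
    m(c) + 2 c_i and m(c) - 2 c_i by (c,c) plus a constant; on the quadric m(c)
    cancels against (c,c). *)
Lemma quadric_bounded (m : C -> int) : exists N : nat, forall c : C -> int,
  \sum_i \sum_j c i * c j * cd_form i j = \sum_i c i * m i ->
  forall i, `|c i| <= N%:Z.
Proof.
pose d (i j : C) : Rdefinitions.R := (i == j)%:R.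
have bounds i : exists N : nat, forall c : C -> int,
  \sum_i \sum_j c i * c j * cd_form i j = \sum_i c i * m i -> `|c i| <= N%:Z.
  have [b1 b1P] := form_dominates_linear (fun j => (m j)%:~R / 2 + d j i) Cfin.
  have [b2 b2P] := form_dominates_linear (fun j => (m j)%:~R / 2 - d j i) Cfin.
  have [N Nge] : exists N : nat, Num.max b1 b2 <= N%:R.
    by exists (Num.truncn (Num.max b1 b2)).+1; apply/ltW/truncnS_gt.
  exists N => c qc; pose x j : Rdefinitions.R := (c j)%:~R.
  have dE : \sum_j x j * d j i = x i.
    rewrite (bigD1 i) //= /d eqxx mulr1 big1 ?addr0 // => j /negPf->.
    by rewrite mulr0.
  have qx : \sum_i \sum_j x i * x j * (cd_form i j)%:~R
      = \sum_j x j * (m j)%:~R.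
    have /(congr1 (fun z : int => z%:~R : Rdefinitions.R)) := qc.
    rewrite !rmorph_sum /= => qc'; rewrite (eq_bigr _ (fun j _ => intrM _ _ _)) in qc'.
    rewrite -qc'; apply: eq_bigr => j _; rewrite rmorph_sum.
    by apply: eq_bigr => k _; rewrite !rmorphM.
  have hE : 2 * (\sum_j x j * ((m j)%:~R / 2)) = \sum_j x j * (m j)%:~R.
    by rewrite mulr_sumr; apply: eq_bigr => j _; field.
  have := b1P x; have := b2P x; rewrite qx.
  under eq_bigr do rewrite mulrBr.
  rewrite sumrB dE mulrBr hE.
  under [X in _ -> 2 * X <= _ -> _]eq_bigr do rewrite mulrDr.
  rewrite big_split /= dE mulrDr hE.
  move: Nge; rewrite ge_max => /andP[Nge1 Nge2] le1 le2.
  rewrite -(ler_int Rdefinitions.R) intr_norm -pmulrn ler_norml.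
  have N0 : 0 <= N%:R :> Rdefinitions.R by [].
  by apply/andP; split; rewrite -/(x i); lra.
have [f fP] := choice bounds.
exists (\max_i f i) => c qc i; apply: le_trans (fP i c qc) _.
by rewrite lez_nat; apply: leq_bigmax.
Qed.

Lemma weyl_orbit_finite (x : rd_X D) :
  exists s : seq (rd_X D), forall w, weyl w -> w x \in s.
Proof.
have [N NP] := quadric_bounded (fun i => cd_form i i * <<'h_i, x>>).
(* The box |c_i| <= N is enumerated by k_i = c_i + N in {0, ..., 2N}. *)
exists [seq x - \sum_i 'a_i *~ ((k i : nat)%:Z - N%:Z)
         | k : {ffun C -> 'I_(N + N).+1}] => w Ww.
have [c [-> /NP cN]] := weyl_orbit_quadric x Ww.
apply/mapP; exists [ffun i => inord (absz (c i + N%:Z))].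
  by rewrite mem_enum.
congr (_ - _); apply: eq_bigr => i _; rewrite ffunE inordK.
  by congr (_ *~ _); have := cN i; lia.
by have := cN i; lia.
Qed.

Lemma weyl_orbits_finite (pi : {fset rd_X D}) :
  exists P : {fset rd_X D}, forall x, x \in P <-> weyl_orbits pi x.
Proof.
have [s sP] := choice weyl_orbit_finite.
exists [fset x in flatten [seq s y | y <- pi] | `[< weyl_orbits pi x >]]%fset.
move=> x; rewrite !inE /=; split=> [/andP[_ /asboolP//]|Wx].
apply/andP; split; last exact/asboolP.
have [w [y [Ww piy ->]]] := Wx.
by apply/flattenP; exists (s y); [apply: map_f | apply: sP].
Qed.

End WeylOrbits.

(** * Interpolation and evaluation of polynomials *)

(** A product over y of affine functions in one coordinate, chosen where the
    points of x and y differ. *)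
Lemma lagrange_mpoly (K : fieldType) (T : choiceType) (s : {fset T}) (n : nat)
    (z : T -> 'I_n -> K) :
  (forall x y, z x =1 z y -> x = y) ->
  exists p : T -> {mpoly K[n]},
    forall x y, y \in s -> (p x).@[z y] = (x == y)%:R.
Proof.
move=> z_inj.
have sep (xy : T * T) : exists q : {mpoly K[n]},
    xy.1 != xy.2 -> q.@[z xy.1] = 1 /\ q.@[z xy.2] = 0.
  case: xy => x y /=; have [_|xy] := eqVneq x y; first by exists 0.
  have /existsNP[a /eqP za] : ~ (z x =1 z y).
    by move=> /z_inj /eqP; rewrite (negPf xy).
  exists ((z x a - z y a)^-1 *: ('X_a - (z y a)%:MP)) => _.
  rewrite !mevalZ !mevalB !mevalXU !mevalC subrr mulr0; split=> //.
  by rewrite mulVf // subr_eq0.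
have [q qP] := choice sep.
exists (fun x => \prod_(y <- s | y != x) q (x, y)) => x y sy.
rewrite rmorph_prod /=; have [<-|xy] := eqVneq x y.
  by rewrite big1 // => t tx; have [] := qP (x, t); rewrite //= eq_sym.
rewrite (big_rem y) //= eq_sym xy.
by have [//|_ /= ->] := qP (x, y); rewrite mul0r.
Qed.

Lemma scaler_algC (K : nzRingType) (A : algType K) (V : lmodType A)
    (a : A) (k : K) (m : V) : a *: (k%:A *: m) = k%:A *: (a *: m).
Proof. by rewrite !scalerA mulr_algl mulr_algr. Qed.

Lemma scaler_algM (K : nzRingType) (A : algType K) (V : lmodType A)
    (k l : K) (m : V) : k%:A *: (l%:A *: m) = (k * l)%:A *: m.
Proof. by rewrite [LHS]scalerA mulr_algl scalerA. Qed.

(** On a common eigenvector every word in the e_a acts by the product of the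
    eigenvalues, in whatever order its letters come. *)
Lemma mmap_eigenvector (K : comNzRingType) (A : algType K) (V : lmodType A)
    (n : nat) (e : 'I_n -> A) (z : 'I_n -> K) (m : V) :
  (forall a, e a *: m = (z a)%:A *: m) ->
  forall p : {mpoly K[n]}, mpoly.mmap (in_alg A) e p *: m = p.@[z]%:A *: m.
Proof.
move=> em p.
have eX k a : (e a ^+ k) *: m = (z a ^+ k)%:A *: m.
  elim: k => [|k IHk]; first by rewrite !expr0 !scale1r.
  by rewrite exprSr -scalerA em scaler_algC IHk scaler_algM -exprS.
have e_mmap1 (mu : 'X_{1..n}) :
    mpoly.mmap1 e mu *: m = (mpoly.mmap1 z mu)%:A *: m.
  rewrite /mpoly.mmap1; elim/big_rec2: _ => [|a y1 y2 _ IH].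
    by rewrite !scale1r.
  by rewrite -scalerA IH scaler_algC eX scaler_algM mulrC.
rewrite /mpoly.mmap mevalE scaler_suml -in_algE rmorph_sum scaler_suml.
apply: eq_bigr => mu _.
by rewrite -scalerA e_mmap1 /= scaler_algM.
Qed.

(** The e_a generate a commutative subalgebra, although the algebra they live in,
    such as U with the K_{H_a}, is not commutative. *)
Lemma mmap_comm_monoid_morphism (K : comNzRingType) (A : algType K) (n : nat)
    (e : 'I_n -> A) :
  (forall a b, GRing.comm (e a) (e b)) ->
  monoid_morphism (mpoly.mmap (in_alg A) e).
Proof.
move=> eC; split; first by rewrite -mpolyC1 mmapC /= scale1r.
have e_mmap1 (mu nu : 'X_{1..n}) :
    mpoly.mmap1 e (mu + nu)%MM = mpoly.mmap1 e mu * mpoly.mmap1 e nu.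
  rewrite /mpoly.mmap1.
  (* The induction must carry along that the first product commutes with each
     e_b. *)
  suff [] : (\prod_(a < n) e a ^+ (mu + nu)%MM a
        = (\prod_(a < n) e a ^+ mu a) * (\prod_(a < n) e a ^+ nu a)) /\
      forall b, GRing.comm (\prod_(a < n) e a ^+ mu a) (e b) by [].
  elim/big_rec3: _ => [|a x y z _ [-> zC]].
    by split=> [|b]; [rewrite mulr1 | exact/commr_sym/commr1].
  split=> [|b]; last first.
    by apply/commr_sym/commrM; [apply/commrX/eC | apply/commr_sym/zC].
  rewrite mnmDE exprD -!mulrA; congr (_ * _); rewrite !mulrA; congr (_ * _).
  exact/esym/commrX.
move=> p q; rewrite [in LHS](mpolyE p) [in LHS](mpolyE q) big_distrlr /=.
rewrite raddf_sum [in RHS]/mpoly.mmap big_distrlr /=; apply: eq_bigr => mu _.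
rewrite raddf_sum; apply: eq_bigr => nu _ /=.
rewrite -scalerAl -scalerAr -mpolyXD !mmapZ mmapX e_mmap1 /=.
by rewrite !mulr_algl -scalerAl -scalerAr.
Qed.

(** * The quotient by an ideal as a left module *)

Section QuotientModule.
Variables (K : nzRingType) (A : algType K) (S : A -> Prop).
Hypothesis S1 : ~ ideal_gen S 1.

(** An alias of the quotient algebra: the left A-module structure then does not
    compete with its K-module structure. *)
Definition quot_module : Type := alg_quot S1.
HB.instance Definition _ := GRing.Zmodule.on quot_module.

Definition quot_scale (a : A) (x : quot_module) : quot_module :=
  alg_pi S1 a * (x : alg_quot S1).

Fact quot_scaleA a b x : quot_scale a (quot_scale b x) = quot_scale (a * b) x.
Proof. by rewrite /quot_scale rmorphM mulrA. Qed.
Fact quot_scale1 : left_id 1 quot_scale.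
Proof. by move=> x; rewrite /quot_scale rmorph1 mul1r. Qed.
Fact quot_scaleDr : right_distributive quot_scale +%R.
Proof. by move=> a x y; rewrite /quot_scale mulrDr. Qed.
Fact quot_scaleDl x : {morph quot_scale^~ x : a b / a + b}.
Proof. by move=> a b; rewrite /quot_scale rmorphD mulrDl. Qed.
HB.instance Definition _ := GRing.Zmodule_isLmodule.Build A quot_module
  quot_scaleA quot_scale1 quot_scaleDr quot_scaleDl.

Definition quot_class (a : A) : quot_module := alg_pi S1 a.

Lemma quot_class_surj (x : quot_module) : exists a, x = quot_class a.
Proof. by have [a ->] := alg_pi_surj x; exists a. Qed.

Lemma quot_classP a b : quot_class a = quot_class b <-> ideal_gen S (a - b).
Proof. exact: alg_piP. Qed.

Lemma quot_classM a b : a *: quot_class b = quot_class (a * b).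
Proof. by rewrite /quot_class rmorphM. Qed.

End QuotientModule.

(** * Weight spaces and the ideal of the weight points *)

Section Weights.
Variables (C : cartan_datum) (D : root_datum C) (K : fieldType) (v : K).
Local Notation X := (rd_X D).
Local Notation Y := (rd_Y D).
Local Notation "<< h , x >>" := (rd_pair h x).
Hypothesis v_inj : injective (fun k : int => v ^ k).

Lemma v_neq0 : v != 0.
Proof.
apply/eqP => v0; suff /v_inj : v ^ 1 = v ^ 2%:Z by [].
by rewrite v0 !exp0rz.
Qed.

Lemma UK0 : UK v (0 : Y) = 1.
Proof.
apply/alg_piP; exact/ideal_gen_mem/Urel_K0.
Qed.

Lemma UKD h h' : UK v (h + h') = UK v h * UK v h' :> U D v.
Proof.
rewrite -[RHS]rmorphM; apply/esym/alg_piP; apply: ideal_gen_mem.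
exact: Urel_KD.
Qed.

Section Basis.
Variables (n : nat) (H : 'I_n -> Y).
Hypothesis H_basis : Zbasis H.

Definition weight_point (x : X) (a : 'I_n) : K := v ^ <<H a, x>>.

Lemma pair_zmod_morphism (x : X) : zmod_morphism (fun h : Y => << h, x >>).
Proof.
move=> h h'; apply/eqP; rewrite eq_sym subr_eq; apply/eqP.
by rewrite -rd_pairDl subrK.
Qed.

Lemma weight_point_inj x y : weight_point x =1 weight_point y -> x = y.
Proof.
move=> xy; pose g z : {additive Y -> int} := HB.pack (fun h : Y => << h, z >>)
  (GRing.isZmodMorphism.Build _ _ _ (pair_zmod_morphism z)).
have [t [_ tP]] := rd_perfectr (g x).
rewrite -(tP x) // -(tP y) // => h.
have [c [-> _]] := H_basis h.
change (g x (\sum_a H a *~ c a) = g y (\sum_a H a *~ c a)).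
rewrite !raddf_sum; apply: eq_bigr => a _; rewrite !raddfMz.
by congr (_ *~ _); apply: v_inj; apply: xy.
Qed.

(** The h in Y acting on m by v^<h,x> form a subgroup, as K_h is invertible. *)
Lemma weight_spaceP (V : lmodType (U D v)) (x : X) (m : V) :
  weight_space x m <-> forall a, UK v (H a) *: m = (weight_point x a)%:A *: m.
Proof.
split=> [m_x a|m_x h]; first exact: m_x.
pose P h := UK v h *: m = (v ^ << h, x >>)%:A *: m.
have P0 : P 0.
  rewrite /P UK0 (_ : << 0, x >> = 0) ?expr0z ?scale1r //.
  by have := pair_zmod_morphism x 0 0; rewrite !subrr.
have PD h1 h2 : P h1 -> P h2 -> P (h1 + h2).
  rewrite /P => E1 E2; rewrite UKD -scalerA E2 scaler_algC E1 scaler_algM.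
  by rewrite rd_pairDl expfzDr ?v_neq0 // mulrC.
have PN h1 : P h1 -> P (- h1).
  move=> E1; rewrite /P.
  have {1}-> : m = (v ^ << - h1, x >>)%:A *: (UK v h1 *: m).
    rewrite E1 scaler_algM -expfzDr ?v_neq0 // -rd_pairDl addNr.
    by rewrite -P0 UK0 scale1r.
  by rewrite scaler_algC; congr (_ *: _); rewrite scalerA -UKD addNr UK0 scale1r.
have Pn h1 k : P h1 -> P (h1 *+ k).
  by move=> E1; elim: k => [|k IHk]; rewrite ?mulr0n ?mulrS //; apply: PD.
have [c [-> _]] := H_basis h; elim/big_ind: _ => // a _.
case: (c a) => k; first exact/Pn/m_x.
by rewrite NegzE mulrNz; apply/PN/Pn/m_x.
Qed.

(** Sums of weight spaces are always direct: the interpolation polynomial of x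
    projects a finite sum of weight vectors onto its component of weight x. *)
Lemma weight_direct_sumP (P : X -> Prop) (V : lmodType (U D v)) :
  (forall m : V, exists (s : {fset X}) (f : X -> V),
     (forall x, x \in s -> P x /\ weight_space x (f x)) /\
     m = \sum_(x <- s) f x) ->
  weight_direct_sum P V.
Proof.
move=> spanV; split=> // s f fP sum0 x sx.
have [p pE] := lagrange_mpoly s (@weight_point_inj).
have := congr1 (fun m => mpoly_to_U v H (p x) *: m) sum0.
rewrite scaler_sumr scaler0 (big_rem x) //= big_seq big1 => [|y].
  have [_ /weight_spaceP fx] := fP x sx.
  by rewrite addr0 (mmap_eigenvector fx) pE // eqxx !scale1r.
rewrite mem_rem_uniq ?fset_uniq // inE => /andP[yx sy].
have [_ /weight_spaceP fy] := fP y sy.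
by rewrite (mmap_eigenvector fy) pE // eq_sym (negPf yx) !scale0r.
Qed.

Variable pi : {fset X}.
Local Notation J := (vanishing_ideal_U pi H).

Lemma vanishing_ideal_sub (u : U D v) : J u -> defining_ideal pi u.
Proof.
move=> [p pP ->] V [_ [spanV _]] m.
have [s [f [fP ->]]] := spanV m.
rewrite scaler_sumr big_seq big1 // => x sx.
have [Wx /weight_spaceP fx] := fP x sx.
by rewrite (mmap_eigenvector fx) pP ?scale0r //; exists x.
Qed.

Lemma defining_ideal_gen (S : U D v -> Prop) (u : U D v) :
  (forall x, S x -> defining_ideal pi x) -> ideal_gen S u -> defining_ideal pi u.
Proof.
move=> SP; elim=> [x /SP //||x y _ IHx _ IHy|a x _ IHx|a x _ IHx] V CV m.
- by rewrite scale0r.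
- by rewrite scalerDl IHx // IHy // addr0.
- by rewrite -scalerA IHx // scaler0.
- by rewrite -scalerA IHx.
Qed.

Lemma mpoly_to_U_M : monoid_morphism (mpoly_to_U v H).
Proof.
have KC h h' : GRing.comm (UK v h) (UK v h' : U D v).
  by rewrite /GRing.comm -!UKD addrC.
by apply: mmap_comm_monoid_morphism => a b; apply: KC.
Qed.

Lemma mpoly_to_U0 p : U0 (mpoly_to_U v H p).
Proof.
have U0_0 : @U0 _ D _ v 0 by rewrite -(scale0r 1); apply/U0_Z/U0_1.
have U0_X h k : U0 ((UK v h : U D v) ^+ k).
  by elim: k => [|k IHk]; [apply: U0_1 | rewrite exprS; apply: U0_M IHk; apply: U0_K].
rewrite /mpoly_to_U /mpoly.mmap; elim/big_ind: _ => // [|mu _].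
  exact: U0_D.
rewrite /= mulr_algl; apply: U0_Z; rewrite /mpoly.mmap1.
elim/big_ind: _ => // [|x y]; [exact: U0_1 | exact: U0_M].
Qed.

(** The weight vectors that sum to the class of a are the classes of e_x a,
    where e_x is the image in U of the interpolation polynomial of x. *)
Lemma quot_in_Cpi (P : {fset X}) (J1 : ~ ideal_gen J 1) :
  (forall x, x \in P <-> weyl_orbits pi x) ->
  in_Cpi pi (quot_module J1 : lmodType (U D v)).
Proof.
move=> PP; have [p pE] := lagrange_mpoly P (@weight_point_inj).
pose e x := mpoly_to_U v H (p x) : U D v.
have J_of q : (forall x, x \in P -> q.@[weight_point x] = 0) ->
    ideal_gen J (mpoly_to_U v H q).
  move=> q0; apply: ideal_gen_mem; exists q => // z [x /PP Px zE].
  by rewrite -(q0 x Px); apply: meval_eq.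
have toUM := mpoly_to_U_M.
have sum_e a : ideal_gen J (a - \sum_(x <- P) e x * a).
  rewrite -mulr_suml -[X in X - _]mul1r -mulrBl; apply: ideal_genMr.
  rewrite -toUM.1 -raddf_sum -raddfB; apply: J_of => x Px.
  rewrite mevalB meval1 (raddf_sum (meval (weight_point x))) (big_rem x) //= pE // eqxx.
  rewrite big_seq big1 ?addr0 ?subrr // => y.
  by rewrite mem_rem_uniq ?fset_uniq // inE => /andP[yx Py]; rewrite pE // (negPf yx).
have e_weight x a : x \in P -> weight_space x (quot_class J1 (e x * a)).
  move=> Px; apply/weight_spaceP => b; rewrite !quot_classM.
  apply/quot_classP; rewrite !mulrA -mulrBl; apply: ideal_genMr.
  rewrite -mulrBl.
  have -> : UK v (H b) - (weight_point x b)%:A =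
      mpoly_to_U v H ('X_b - (weight_point x b)%:MP).
    by rewrite /mpoly_to_U raddfB /= mmapX mmap1U mmapC.
  rewrite -toUM.2; apply: J_of => y Py.
  rewrite mevalM mevalB mevalXU mevalC pE //.
  by have [->|_] := eqVneq x y; rewrite ?subrr ?mul0r ?mulr0.
have span m : exists f : X -> quot_module J1,
    (forall x, x \in P -> weight_space x (f x)) /\ m = \sum_(x <- P) f x.
  have [a ->] := quot_class_surj m.
  exists (fun x => quot_class J1 (e x * a)); split=> [x|]; first exact: e_weight.
  rewrite -raddf_sum; apply/quot_classP; exact: sum_e.
split; apply: weight_direct_sumP => m; have [f [fP ->]] := span m;
  exists P, f; split=> // x Px; split; try exact: fP; by [|apply/PP].
Qed.

(** The quotient algebra is only available when 1 is not in J; otherwise J is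
    all of U. *)
Lemma defining_ideal_sub (P : {fset X}) :
  (forall x, x \in P <-> weyl_orbits pi x) ->
  forall u : U D v, defining_ideal pi u -> ideal_gen J u.
Proof.
move=> PP u u0; have [J1|J1] := pselect (ideal_gen J (1 : U D v)).
  by rewrite -[u]mulr1; apply: ideal_genMl.
have := u0 _ (quot_in_Cpi J1 PP) (quot_class J1 1).
rewrite quot_classM mulr1 => E.
by rewrite -[u]subr0; apply/(quot_classP J1); rewrite E /quot_class raddf0.
Qed.

End Basis.
End Weights.

(** * The theorem *)

Lemma qv_exprz_inj : injective (fun k : int => qv ^ k).
Proof.
have qv0 : qv != 0 by rewrite tofrac_eq0 polyX_eq0.
have nat_exp (d : nat) : qv ^ d%:Z = 1 -> d = 0%N.
  rewrite -exprnP /qv -tofracXn -tofrac1 => /eqP; rewrite tofrac_eq => /eqP.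
  by move=> /(congr1 (fun p : {poly rat} => size p)); rewrite size_polyXn size_poly1 => -[].
move=> k l /= kl; apply/eqP; rewrite -subr_eq0; apply/eqP.
have: qv ^ (k - l) = 1 by rewrite expfzDr // kl -expfzDr // subrr.
case: (k - l) => d; first by move=> /nat_exp->.
by rewrite NegzE -invr_expz => /eqP; rewrite invr_eq1 => /eqP/nat_exp.
Qed.

Theorem theorem4p13 (C : cartan_datum) (D : root_datum C)
    (C_finite_type : finite_type C)
    (pi : {fset rd_X D}) (pi_saturated : saturated pi)
    (n : nat) (H : 'I_n -> rd_Y D) (H_basis : Zbasis H) :
  (forall u : U D qv,
     defining_ideal pi u <-> ideal_gen (vanishing_ideal_U pi H) u) /\
  (forall u : U D qv,
     defining_ideal pi u <->
     ideal_gen (fun x => defining_ideal pi x /\ U0 x) u).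
Proof.
have [P PP] := weyl_orbits_finite C_finite_type pi.
have gen := defining_ideal_sub qv_exprz_inj H_basis PP.
have sub := vanishing_ideal_sub qv_exprz_inj H_basis.
split=> u; split; last 1 first.
- by apply: defining_ideal_gen => x [].
- exact: gen.
- by apply: defining_ideal_gen => x; apply: sub.
move=> /gen; elim=> [x Jx||x y _ Ix _ Iy|a x _ Ix|a x _ Ix].
- apply: ideal_gen_mem; split; first exact: sub Jx.
  by have [p _ ->] := Jx; apply: mpoly_to_U0.
- exact: ideal_gen0.
- exact: ideal_genD.
- exact: ideal_genMl.
- exact: ideal_genMr.
Qed.
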